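(* Let $1<a\le b\le2$, let $\alpha:\mathbf{R}\to[a,b]$ be continuous, let $0<H<1$ with $Ha>1$, let $\lambda>0$, and let $X_{H,\alpha(x),\lambda}$ be (a continuous version of) the linear tempered fractional multistable motion. For $t\in\mathbf{R}$ let $$\widetilde{\mathcal{H}}_t(\omega)=\sup\Big\{\gamma:\ \lim_{r\to0}\frac{|X_{H,\alpha(x),\lambda}(t+r,\omega)-X_{H,\alpha(x),\lambda}(t,\omega)|}{|r|^\gamma}=0\Big\}$$ be its pointwise Hölder exponent at $t$. Then for every $t\in\mathbf{R}$, $\widetilde{\mathcal{H}}_t(\omega)\ge H-1/a$ almost surely.
   Context: Conventions: $(x)_+=\max\{x,0\}$ and $0^\gamma=0$ for all $\gamma\in\mathbf{R}$. Set $$G_{H,\alpha(x),\lambda}(t,x)=e^{-\lambda(t-x)_+}(t-x)_+^{H-\frac1{\alpha(x)}}-e^{-\lambda(-x)_+}(-x)_+^{H-\frac1{\alpha(x)}} .$$ The multistable stochastic integral $I(f)=\int f(x)\,dM_\alpha(x)$, defined for measurable $f$ with $\int_{-\infty}^\infty|f(x)|^{\alpha(x)}dx<\infty$, is specified by its finite-dimensional distributions: $\mathbf{E}[e^{i\sum_{k=1}^d\theta_kI(f_k)}]=\exp\{-\int_{-\infty}^\infty|\sum_{k=1}^d\theta_kf_k(x)|^{\alpha(x)}dx\}$. The linear tempered fractional multistable motion (LTFmSM) is $X_{H,\alpha(x),\lambda}(t)=\int_{-\infty}^\infty G_{H,\alpha(x),\lambda}(t,x)\,dM_\alpha(x)$,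 $t\in\mathbf{R}$; thus $$\mathbf{E}\Big[e^{i\sum_{k=1}^d\theta_kX_{H,\alpha(x),\lambda}(t_k)}\Big]=\exp\Big\{-\int_{-\infty}^\infty\Big|\sum_{k=1}^d\theta_kG_{H,\alpha(x),\lambda}(t_k,x)\Big|^{\alpha(x)}dx\Big\}.$$ Under the hypotheses of the claim the process admits a version with continuous paths. *)

(* Defs.v *)
From HB Require Import structures.
From mathcomp Require Export all_boot all_order all_algebra.
From mathcomp Require Export all_classical all_reals all_analysis.
From mathcomp.real_closed Require Export complex.
Export Order.TTheory GRing.Theory Num.Theory.
Export numFieldNormedType.Exports.

Set Implicit Arguments.
Unset Strict Implicit.
Unset Printing Implicit Defensive.

Local Open Scope classical_set_scope.
Local Open Scope ring_scope.

Section Kernel.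
Context {R : realType}.
Implicit Types (x t g H lambda : R) (alpha : R -> R).

Definition pos_part x : R := Num.max x 0.

(* The convention 0^g = 0 holds for every g, including g = 0, whereas
   powR 0 0 = 1. *)
Definition pow0 x g : R := if x == 0 then 0 else x `^ g.

Definition ltfm_kernel H alpha lambda t x : R :=
  expR (- (lambda * pos_part (t - x))) *
    pow0 (pos_part (t - x)) (H - (alpha x)^-1)
  - expR (- (lambda * pos_part (- x))) *
    pow0 (pos_part (- x)) (H - (alpha x)^-1).

Definition multistable_integrable alpha (f : R -> R) : Prop :=
  measurable_fun [set: R] f /\
  (\int[lebesgue_measure]_x (`|f x| `^ alpha x)%:E < +oo)%E.

Definition holder_exponent (f : R -> R) t : \bar R :=
  ereal_sup [set g%:E | g in
    [set g : R | (fun r : R => `|f (t + r) - f t| / (`|r| `^ g)) @ 0^' --> (0 : R)]].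

End Kernel.

Section Processes.
Context {R : realType} {d : measure_display} {Omega : measurableType d}.
Variable P : probability Omega R.

Definition expi (x : R) : R[i] := (cos x +i* sin x)%C.

Definition cexpectation (Z : Omega -> R[i]) : R[i] :=
  ((\int[P]_w complex.Re (Z w)) +i* (\int[P]_w complex.Im (Z w)))%C.

(* (Y i) is the family of the integrals of the (f i) with respect to the
   alpha-multistable random measure. These integrals are specified only through
   their joint laws, so this is a property of the finite-dimensional
   distributions of Y; it says nothing about an f i outside the domain of the
   integral. *)
Definition multistable_integrals (alpha : R -> R) (I : Type)
    (f : I -> R -> R) (Y : I -> {RV P >-> R}) : Prop :=
  forall (n : nat) (theta : 'I_n -> R) (i : 'I_n -> I),
    (forall k, multistable_integrable alpha (f (i k))) ->
    cexpectation (fun w => expi (\sum_(k < n) theta k * Y (i k) w)) =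
    (expR (- (\int[lebesgue_measure]_x
                (`|\sum_(k < n) theta k * f (i k) x| `^ alpha x))))%:C%C.

Definition LTFmSM (H : R) (alpha : R -> R) (lambda : R)
    (X : R -> {RV P >-> R}) : Prop :=
  multistable_integrals alpha (ltfm_kernel H alpha lambda) X.

Definition version (X Y : R -> {RV P >-> R}) : Prop :=
  forall t, {ae P, forall w, X t w = Y t w}.

Definition continuous_paths (X : R -> {RV P >-> R}) : Prop :=
  {ae P, forall w, continuous (fun t : R => (X t w : R))}.

End Processes.

(* Main.v *)
Require Import Defs.
From mathcomp Require Import measurable_realfun zify ring lra.

(** At the point [x], the kernels [G(t, .)] and [G(s, .)] differ by the increment
    of a tempered power from [s - x] to [t - x].  With [r = t - s], it is at most
    [(2r)^(H - 1/alpha(x))] for [s - x <= r] and, by the mean value theorem, at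
    most [r (s - x)^(H - 1/alpha(x) - 1)] further away; raised to the power
    [alpha(x)] and integrated this gives, for the characteristic function of
    [X t - X s], a bound [1 - E cos(theta (X t - X s)) <= K (y^a + y^b)] with
    [y = 2 theta r^H].  Evaluating it at [theta = 1/(2^k delta)] bounds the
    probability that [|X t - X s|] lies in [[2^k delta, 2^(k+1) delta]], and
    summing over [k] gives [P(|X t - X s| >= delta) <= D (2 r^H / delta)^a].
    For [g < H - 1/a] the events that one of the [2^n] dyadic increments of
    level [n] next to [t] exceeds [2^(-ng)] then have summable probabilities;
    Borel-Cantelli and dyadic chaining along a continuous path finish the
    proof. *)

Local Open Scope classical_set_scope.
Local Open Scope ring_scope.

(** * Deterministic part: dyadic chaining and Hölder quotients *)

(** The chain runs through the binary truncations of [r]. It starts at 0 because [r] is below 2^-m;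
    each new binary digit moves it by at most one step of the new level, so the increments form a
    geometric series, and continuity gives the limit. *)
Lemma dyadic_increment_bound (R : realType) (f : R -> R) (q : R) (N m : nat)
    (r : R) :
  0 < q < 1 -> continuous f ->
  (forall n k, (N <= n)%N -> (k < 2 ^ n)%N ->
    `|f (k.+1%:R / 2 ^+ n) - f (k%:R / 2 ^+ n)| <= q ^+ n) ->
  (N <= m)%N -> 0 <= r < (2 ^+ m)^-1 ->
  `|f r - f 0| <= q ^+ m / (1 - q).
Proof.
move=> /andP[q0 q1] cf fincr Nm /andP[r0 rm].
have e2 n : 0 < 2 ^+ n :> R by exact: exprn_gt0.
pose k n := Num.truncn (r * 2 ^+ n).
have kr n : (k n)%:R <= r * 2 ^+ n < (k n).+1%:R.
  by apply: truncn_itv; rewrite mulr_ge0// ltW.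
have kS n : k n.+1 = (2 * k n)%N \/ k n.+1 = (2 * k n).+1.
  have /andP[l1 u1] := kr n; have /andP[l2 u2] := kr n.+1.
  have h1 : (2 * k n < (k n.+1).+1)%N.
    rewrite -(ltr_nat R) natrM (le_lt_trans _ u2)// exprS mulrCA.
    by rewrite ler_wpM2l.
  have h2 : (k n.+1 < 2 * (k n).+1)%N.
    rewrite -(ltr_nat R) natrM (le_lt_trans l2)// exprS mulrCA.
    by rewrite ltr_pM2l.
  by lia.
have kE n : k n.+1 = (2 * k n)%N ->
    (k n.+1)%:R / 2 ^+ n.+1 = (k n)%:R / 2 ^+ n :> R.
  by move=> ->; rewrite natrM exprS invfM mulrACA divff ?mul1r.
have step n : (N <= n.+1)%N ->  (2 ^ n.+1 > k n.+1)%N ->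
    `|f ((k n.+1)%:R / 2 ^+ n.+1) - f ((k n)%:R / 2 ^+ n)| <= q ^+ n.+1.
  move=> Nn kn; case: (kS n) => h.
    by rewrite kE// subrr normr0 exprn_ge0// ltW.
  have -> : (k n)%:R / 2 ^+ n = (2 * k n)%N%:R / 2 ^+ n.+1 :> R.
    by rewrite natrM exprS invfM mulrACA divff ?mul1r.
  rewrite h; apply: fincr => //.
  by rewrite h in kn; apply: ltn_trans kn.
have k_lt n : (m <= n)%N -> (k n < 2 ^ n)%N.
  move=> mn; have /andP[l _] := kr n; rewrite -(ltr_nat R) (le_lt_trans l)//.
  rewrite natrX -ltr_pdivlMr// divff ?gt_eqF//.
  rewrite (lt_le_trans rm)// invf_le1// exprn_ege1//.
  by rewrite ler1n.
have km0 : k m = 0%N.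
  have /andP[l _] := kr m; apply/eqP; rewrite -leqn0 -ltnS -(ltr_nat R).
  by rewrite (le_lt_trans l)// -ltr_pdivlMr// div1r.
have bound j : `|f ((k (m + j)%N)%:R / 2 ^+ (m + j)) - f 0| <=
    q ^+ m * (1 - q ^+ j) / (1 - q).
  elim: j => [|j IH].
    by rewrite addn0 km0 mul0r subrr normr0 expr0 subrr mulr0 mul0r.
  rewrite addnS (le_trans (ler_distD (f ((k (m + j)%N)%:R / 2 ^+ (m + j))) _ _))//.
  apply: (le_trans (lerD (step _ _ _) IH)).
  - by rewrite leqW// (leq_trans Nm)// leq_addr.
  - by apply: k_lt; rewrite leqW// leq_addr.
  have -> : q ^+ m * (1 - q ^+ j.+1) / (1 - q) =
      q ^+ (m + j) + q ^+ m * (1 - q ^+ j) / (1 - q).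
    by rewrite exprD exprS; field; rewrite subr_eq0 gt_eqF.
  (* The new step costs at most q^(m+j+1); rounding it up to q^(m+j) gives the closed form in
     [bound]. *)
  by rewrite lerD2r exprS ler_piMl// ?exprn_ge0// ltW.
have kcvg : (k (m + j)%N)%:R / 2 ^+ (m + j) @[j --> \oo] --> r.
  have lim0 : r - 2^-1 ^+ j @[j --> \oo] --> r.
    rewrite -[X in _ --> X]subr0; apply: cvgB; first exact: cvg_cst.
    by apply: cvg_expr; rewrite ger0_norm ?invr_ge0// invf_lt1// ltr1n.
  apply: (squeeze_cvgr _ lim0 (cvg_cst r)).
  apply: nearW => j; have /andP[l u] := kr (m + j)%N.
  rewrite ler_pdivrMr// l andbT ler_pdivlMr// mulrBl lerBlDr (le_trans (ltW u))//.
  rewrite -natr1 lerD2l exprD mulrCA exprVn mulVf ?gt_eqF// mulr1.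
  by rewrite exprn_ege1// ler1n.
have fcvg : `|f ((k (m + j)%N)%:R / 2 ^+ (m + j)) - f 0| @[j --> \oo] -->
    `|f r - f 0|.
  apply: cvg_norm; apply: cvgB; last exact: cvg_cst.
  exact: (continuous_cvg _ (cf _) kcvg).
rewrite -(cvg_lim _ fcvg)//; apply: limr_le.
  by apply/cvg_ex; eexists; exact: fcvg.
apply: nearW => j; rewrite (le_trans (bound j))//.
have q1' : 0 < 1 - q by rewrite subr_gt0.
rewrite ler_pdivrMr// divfK ?gt_eqF// ler_piMr ?exprn_ge0 ?ltW// gtrBl.
exact: exprn_gt0.
Qed.

(** Bracketing [|r|] between consecutive powers of 1/2 turns the dyadic bound into C 2^g |r|^g;
    dividing by |r|^h leaves a positive power of |r|. *)
Lemma cvg_holder_quotient (R : realType) (f : R -> R) (t g h C : R) (N : nat) :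
  0 < g -> h < g -> 0 <= C ->
  (forall m r, (N <= m)%N -> `|r| < (2 ^+ m)^-1 ->
    `|f (t + r) - f t| <= C * (2 `^ (- g)) ^+ m) ->
  (fun r => `|f (t + r) - f t| / (`|r| `^ h)) @ 0^' --> (0 : R).
Proof.
move=> g0 hg C0 fle.
have norm0 : `|r| @[r --> (0 : R)^'] --> (0 : R)^'+.
  move=> A /nbhs_ballP[e e0 Ae]; apply/nbhs_ballP; exists e => // r.
  rewrite -ball_normE/= sub0r normrN => re r0.
  apply: Ae; last by rewrite normr_gt0.
  by rewrite -ball_normE/= sub0r normrN normr_id.
have ub : C * 2 `^ g * `|r| `^ (g - h) @[r --> (0 : R)^'] --> (0 : R).
  rewrite -[X in _ --> X](mulr0 (C * 2 `^ g)); apply: cvgM; first exact: cvg_cst.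
  have gh : 0 < g - h by rewrite subr_gt0.
  exact: cvg_comp norm0 (powR_cvg0 gh).
apply: (squeeze_cvgr _ (cvg_cst 0) ub).
near=> r.
have r0 : 0 < `|r|.
  by rewrite normr_gt0; near: r; exact: nbhs_dnbhs_neq.
have rN : `|r| < (2 ^+ N)^-1.
  near: r; apply: dnbhs0_lt; first by rewrite invr_gt0 exprn_gt0.
rewrite divr_ge0 ?powR_ge0//= ler_pdivrMr ?powR_gt0// -[leRHS]mulrA -powRD; last first.
  by rewrite (gt_eqF r0) implybT.
rewrite subrK.
have exm : exists m : nat, (2 ^+ m)^-1 <= `|r|.
  exists (Num.truncn (`|r|^-1)).+1.
  rewrite invf_ple ?posrE ?exprn_gt0//.
  have rV0 : 0 <= `|r|^-1 by rewrite invr_ge0.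
  have /andP[_ /ltW rn] := truncn_itv rV0.
  by rewrite (le_trans rn)// -natrX ler_nat ltnW// ltn_expl.
(* The least such [m] exceeds [N], hence is positive, and minimality gives |r| < 2^-(m-1). *)
case: (ex_minnP exm) => m mr mmin.
have Nm : (N < m)%N.
  rewrite ltnNge; apply/negP => mN.
  have := le_lt_trans mr rN; rewrite ltf_pV2 ?posrE ?exprn_gt0// ltNge.
  by rewrite ler_eXn2l ?ltr1n// mN.
case: m Nm mr mmin => // m Nm mr mmin.
have rm : `|r| < (2 ^+ m)^-1.
  by rewrite ltNge; apply/negP => /mmin; rewrite ltnn.
rewrite (le_trans (fle m r Nm rm))// -mulrA ler_wpM2l//.
rewrite -powRM// -powR_mulrn ?powR_ge0// -powRrM mulNr mulrC -mulNr powRrM.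
rewrite powR_invn// ge0_ler_powR ?(ltW g0) ?nnegrE ?invr_ge0 ?mulr_ge0//.
by move: mr; rewrite exprS invfM ler_pdivrMl.
Unshelve. all: by end_near. Qed.

Lemma nneseries_geometric_le (R : realType) (u : (\bar R)^nat) (c z : R) :
  0 <= c -> 0 <= z < 1 -> (forall n, (0 <= u n)%E) ->
  (forall n, (u n <= (c * z ^+ n)%:E)%E) ->
  (\sum_(n <oo) u n <= (c / (1 - z))%:E)%E.
Proof.
move=> c0 /andP[z0 z1] u0 uc.
apply: lime_le; first exact: is_cvg_nneseries.
apply: nearW => n.
apply: (@le_trans _ _ (\sum_(0 <= k < n) (c * z ^+ k))%:E).
  by rewrite -sumEFin; apply: lee_sum => k _; exact: uc.
rewrite lee_fin -mulr_sumr ler_wpM2l//.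
have z1' : 0 < 1 - z by rewrite subr_gt0.
rewrite -[leRHS]mul1r ler_pdivlMr// mulrC.
have -> : (1 - z) * (\sum_(0 <= k < n) z ^+ k) = 1 - z ^+ n.
  elim: n => [|n IH]; first by rewrite big_geq// mulr0 expr0 subrr.
  by rewrite big_nat_recr//= mulrDr IH exprS; ring.
by rewrite gerBl exprn_ge0.
Qed.

Lemma powR2N_lt1 (R : realType) (a : R) : 0 < a -> 2 `^ (- a) < 1.
Proof.
move=> a0; rewrite powRN invf_lt1 ?powR_gt0//.
have : 1 `^ a < 2 `^ a by apply: gt0_ltr_powR; rewrite ?nnegrE// ltr1n.
by rewrite powR1.
Qed.

(** * Tail probabilities from the characteristic function *)

Section Tail.
Context {R : realType} {d : measure_display} {Omega : measurableType d}.
Variable P : probability Omega R.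

Lemma bounded_cos_integrable (Y : {RV P >-> R}) (theta : R) :
  P.-integrable [set: Omega] (EFin \o (fun w => cos (theta * Y w))).
Proof.
apply: measurable_bounded_integrable => //=.
- by rewrite probability_setT ltry.
- apply: measurableT_comp.
    by apply: continuous_measurable_fun; exact: continuous_cos.
  by apply: measurable_funM.
- exists 1; split; first exact: num_real.
  move=> x x1 w _ /=; rewrite (le_trans _ (ltW x1))// ler_norml.
  by rewrite cos_geN1 cos_le1.
Qed.

Lemma measurable_norm_itv (Y : {RV P >-> R}) (i : interval R) :
  measurable [set w | `|Y w|%R \in i].
Proof.
rewrite (_ : [set w | _] = ((@Num.norm R R) \o Y) @^-1` [set` i])//.
by rewrite -[X in measurable X]setTI; apply: measurableT_comp.
Qed.

Lemma one_sub_cos1_gt0 : 0 < 1 - cos 1 :> R.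
Proof.
rewrite subr_gt0 -[ltRHS]cos0 ltr_cos// in_itv/= ?lexx ?pi_ge0//.
by rewrite ler01/= (le_trans _ (pi_ge2 _))// ler1n.
Qed.

(** Markov's inequality for 1 - cos(Y/x): on the annulus |Y|/x lies in [1, 2], inside [0, pi], where
    the cosine decreases, so 1 - cos(Y/x) is at least 1 - cos 1. *)
Lemma annulus_probability_le (Y : {RV P >-> R}) (x : R) :
  0 < x ->
  (P [set w | `|Y w|%R \in `[x, 2 * x]%R] <=
   ((1 - \int[P]_w cos (x^-1 * Y w)) / (1 - cos 1))%:E)%E.
Proof.
move=> x0.
set A := [set w | _].
have mA : measurable A by exact: measurable_norm_itv.
have c1 := one_sub_cos1_gt0.
have intA : P.-integrable [set: Omega] (EFin \o (\1_A : Omega -> R)).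
  by apply: integrable_indic => //; rewrite setIT -ge0_fin_numE// fin_num_measure.
have intA1 : \int[P]_w (\1_A w) = fine (P A).
  by rewrite /Rintegral integral_indic// setIT.
rewrite -[leLHS]fineK ?fin_num_measure// lee_fin ler_pdivlMr// -intA1 mulrC.
rewrite -RintegralZl//.
have -> : 1 - \int[P]_w cos (x^-1 * Y w) = \int[P]_w (1 - cos (x^-1 * Y w)).
  rewrite RintegralB//.
  - rewrite Rintegral_cst// mul1r; congr (_ - _).
    by have /(congr1 fine) := probability_setT P.
  - exact: finite_measure_integrable_cst.
  - exact: bounded_cos_integrable.
apply: le_Rintegral => //.
- rewrite (_ : _ \o _ = (fun w => (1 - cos 1)%:E * (\1_A w)%:E)%E) //.
  exact: integrableZl.
- rewrite (_ : _ \o _ =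
    (fun w => 1%:E - (EFin \o (fun w => cos (x^-1 * Y w))) w)%E)//.
  apply: integrableB => //; last exact: bounded_cos_integrable.
  exact: finite_measure_integrable_cst.
move=> w _ /=; rewrite indicE; case: (boolP (w \in A)) => [|_]; last first.
  by rewrite mulr0 subr_ge0 cos_le1.
rewrite inE /A/= in_itv/= => /andP[xY Yx].
rewrite mulr1 lerD2l lerN2 -cos_norm normrM.
rewrite (gtr0_norm (_ : 0 < x^-1)) ?invr_gt0// mulrC.
have h1 : 1 <= `|Y w| / x by rewrite ler_pdivlMr// mul1r.
have h2 : `|Y w| / x <= 2 by rewrite ler_pdivrMr.
have pi2 := pi_ge2 R.
by rewrite leNgt ltr_cos -?leNgt// in_itv/=; apply/andP; split; lra.
Qed.

(** The tail is covered by the annuli of inner radius 2^k delta. Taking theta as the reciprocal of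
    that radius bounds the k-th one by a multiple of 2^(-ka), and the geometric series is summed. *)
Lemma tail_probability_le (Y : {RV P >-> R}) (K rho delta a b : R) :
  0 < a -> a <= b -> 0 <= K -> 0 < rho -> rho <= delta ->
  (forall theta, 0 < theta -> 1 - \int[P]_w cos (theta * Y w) <=
     K * ((theta * rho) `^ a + (theta * rho) `^ b)) ->
  (P [set w | `|Y w|%R \in `[delta, +oo[%R] <=
   (2 * K / (1 - cos 1) / (1 - 2 `^ (- a)) * (rho / delta) `^ a)%:E)%E.
Proof.
move=> a0 ab K0 rho0 rd cfY.
have d0 : 0 < delta by exact: lt_le_trans rd.
pose x k : R := 2 ^+ k * delta.
have x0 k : 0 < x k by rewrite mulr_gt0// exprn_gt0.
pose A k := [set w | `|Y w| \in `[x k, 2 * x k]].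
have cover : [set w | `|Y w| \in `[delta, +oo[] `<=` \bigcup_k A k.
  move=> w /=; rewrite in_itv/= andbT => dY.
  have exn : exists n : nat, `|Y w| < 2 ^+ n * delta.
    exists (Num.truncn (`|Y w| / delta)).+1; rewrite -ltr_pdivrMr//.
    have /andP[_ u] := truncn_itv (divr_ge0 (normr_ge0 (Y w)) (ltW d0)).
    by rewrite (lt_trans u)// -natrX ltr_nat ltn_expl.
  case: (ex_minnP exn) => -[|k] Yk kmin.
    by move: Yk; rewrite expr0 mul1r ltNge dY.
  exists k => //; rewrite /A/= in_itv/= /x; apply/andP; split; last first.
    by rewrite mulrA -exprS ltW.
  by rewrite leNgt; apply/negP => /kmin; rewrite ltnn.
have c1 := one_sub_cos1_gt0.
pose z : R := 2 `^ (- a).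
have z0 : 0 < z by rewrite powR_gt0.
have z1 : z < 1.
  exact: powR2N_lt1.
pose D := 2 * K / (1 - cos 1) * (rho / delta) `^ a.
have D0 : 0 <= D.
  by rewrite mulr_ge0 ?powR_ge0// divr_ge0 ?(ltW c1)// mulr_ge0.
have PA k : (P (A k) <= (D * z ^+ k)%:E)%E.
  rewrite (le_trans (annulus_probability_le Y _ (x0 k)))// lee_fin.
  rewrite (_ : D * _ = 2 * K * ((rho / delta) `^ a * z ^+ k) / (1 - cos 1));
    last first.
    by rewrite /D; ring.
  rewrite ler_pdivrMr// divfK ?gt_eqF//.
  rewrite (le_trans (cfY _ _)) ?invr_gt0//.
  have y0 : 0 < (x k)^-1 * rho by rewrite mulr_gt0 ?invr_gt0.
  (* Since theta * rho is at most 1, its [b]-th power is below its [a]-th power; this explains the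
     factor 2 before [K]. *)
  have y1 : (x k)^-1 * rho <= 1.
    rewrite mulrC ler_pdivrMr// mul1r (le_trans rd)// /x ler_peMl ?(ltW d0)//.
    by rewrite exprn_ege1// ler1n.
  have yE : ((x k)^-1 * rho) `^ a = (rho / delta) `^ a * z ^+ k.
    have -> : z ^+ k = (2 ^- k) `^ a.
      rewrite -powR_invn// -powRrM -powR_mulrn ?powR_ge0// -powRrM.
      by congr (_ `^ _); ring.
    rewrite -powRM ?divr_ge0 ?invr_ge0 ?exprn_ge0 ?(ltW rho0) ?(ltW d0)//.
    by congr (_ `^ _); rewrite /x invfM; ring.
  rewrite -yE [2 * K]mulrC -mulrA ler_wpM2l// mulr_natl mulr2n lerD2l.
  by apply: ger_powR; rewrite ?y0.
have mA k : measurable (A k) by exact: measurable_norm_itv.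
have mE := measurable_norm_itv Y `[delta, +oo[.
rewrite (le_trans (measure_sigma_subadditive P mA mE cover))//.
rewrite (_ : _ * _ = D / (1 - z)); last by rewrite /D mulrAC.
by apply: nneseries_geometric_le => //; rewrite (ltW z0).
Qed.
End Tail.

(** * Increments of a tempered power *)

Section TemperedPower.
Context {R : realType}.
Implicit Types (lambda beta r s t u v x : R).

(** [ltfm_kernel] is the difference of two such terms, at t - x and at -x, with exponent H -
    1/alpha(x); the second cancels in increments in [t]. *)
Definition tempered_power lambda beta v : R :=
  expR (- (lambda * pos_part v)) * pow0 (pos_part v) beta.

Lemma tempered_power_le0 lambda beta v : v <= 0 -> tempered_power lambda beta v = 0.
Proof. by move=> v0; rewrite /tempered_power/pos_part max_r// /pow0 eqxx mulr0. Qed.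

Lemma tempered_power_ge0 lambda beta v : 0 <= tempered_power lambda beta v.
Proof.
by rewrite mulr_ge0 ?expR_ge0// /pow0; case: ifP => // _; exact: powR_ge0.
Qed.

Lemma tempered_powerE lambda beta v : 0 < v ->
  tempered_power lambda beta v = expR (- (lambda * v)) * v `^ beta.
Proof. by move=> v0; rewrite /tempered_power /pos_part max_l ?ltW// /pow0 gt_eqF. Qed.

Lemma tempered_power_le lambda beta v w : 0 <= lambda -> 0 <= beta ->
  v <= w -> 0 <= w -> tempered_power lambda beta v <= w `^ beta.
Proof.
move=> l0 b0 vw w0; have [v0|v0] := leP v 0.
  by rewrite tempered_power_le0// powR_ge0.
rewrite tempered_powerE// -[leRHS]mul1r ler_pM ?expR_ge0 ?powR_ge0//.
  by rewrite -expR0 ler_expR oppr_le0 mulr_ge0// ltW.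
by rewrite ge0_ler_powR// nnegrE ltW.
Qed.

(** Both values lie in [0, (2r)^beta], as neither argument exceeds 2r. *)
Lemma tempered_power_near_increment lambda beta r u : 0 <= lambda -> 0 <= beta ->
  0 <= r -> u <= r ->
  `|tempered_power lambda beta (u + r) - tempered_power lambda beta u| <=
    (2 * r) `^ beta.
Proof.
move=> l0 b0 r0 ur.
have h1 := tempered_power_ge0 lambda beta (u + r).
have h2 := tempered_power_ge0 lambda beta u.
have h3 : tempered_power lambda beta (u + r) <= (2 * r) `^ beta.
  by apply: tempered_power_le => //; lra.
have h4 : tempered_power lambda beta u <= (2 * r) `^ beta.
  by apply: tempered_power_le => //; lra.
by rewrite ler_norml; apply/andP; split; lra.
Qed.

(** By the mean value theorem the increment is r e^(-lambda c) c^(beta-1) (beta - lambda c) with c >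
    u. As beta is in (0, 1], |beta - lambda c| <= 1 + lambda c <= e^(lambda c), so the tempering
    absorbs this factor and the bound is uniform in [lambda]. *)
Lemma tempered_power_far_increment lambda beta r u : 0 <= lambda ->
  0 < beta <= 1 -> 0 < r -> 0 < u ->
  `|tempered_power lambda beta (u + r) - tempered_power lambda beta u| <=
    r * u `^ (beta - 1).
Proof.
move=> l0 /andP[b0 b1] r0 u0.
rewrite !tempered_powerE ?addr_gt0//.
pose f v : R := expR (- (lambda * v)) * v `^ beta.
pose f' v : R := expR (- (lambda * v)) * v `^ (beta - 1) * (beta - lambda * v).
have df v : 0 < v -> is_derive v 1 f (f' v).
  move=> v0.
  have d0 : is_derive v 1 (fun x : R => - (lambda * x)) (- lambda).
    rewrite (_ : (fun _ => _) = - (lambda \*: (@idfun R)))//.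
    by apply: is_derive_eq; rewrite /GRing.scale/= mulr1.
  have d1 : is_derive v 1 (expR \o (fun x => - (lambda * x)))
      (expR (- (lambda * v)) * - lambda).
    exact: is_derive1_comp.
  have d2 := is_derive1_powR beta v0.
  rewrite (_ : f = (expR \o (fun x => - (lambda * x))) * (@powR R ^~ beta)) //.
  apply: is_derive_eq.
  rewrite /f' /GRing.scale/= -[v `^ beta](mulr_powRB1 (ltW v0))//.
  ring.
have cf : {within `[u, u + r], continuous f}.
  apply: derivable_within_continuous => x; rewrite in_itv/= => /andP[ux _].
  by have [] := df x (lt_le_trans u0 ux).
have uur : u < u + r by rewrite ltrDl.
have dfu x : x \in `]u, (u + r)[ -> is_derive x 1 f (f' x).
  by rewrite in_itv/= => /andP[ux _]; apply: df; exact: lt_trans ux.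
have [c] := MVT uur dfu cf.
rewrite in_itv/= => /andP[uc _].
have c0 : 0 < c by exact: lt_trans uc.
rewrite addrAC subrr add0r /f => ->.
rewrite normrM (gtr0_norm r0) mulrC ler_wpM2l ?(ltW r0)//.
rewrite /f' !normrM (ger0_norm (expR_ge0 _)) (ger0_norm (powR_ge0 _ _)).
rewrite mulrAC.
have lc : 0 <= lambda * c by rewrite mulr_ge0// ltW.
have h1 : expR (- (lambda * c)) * `|beta - lambda * c| <= 1.
  rewrite expRN mulrC ler_pdivrMr ?expR_gt0// mul1r.
  rewrite (le_trans _ (expR_ge1Dx _))// ler_norml.
  by apply/andP; split; lra.
rewrite -[leRHS]mul1r ler_pM ?powR_ge0 ?mulr_ge0 ?expR_ge0//.
rewrite -opprB !powRN lef_pV2 ?posrE ?powR_gt0//.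
by rewrite ge0_ler_powR ?nnegrE ?subr_ge0 ?(ltW uc) ?(ltW u0) ?(ltW c0).
Qed.
End TemperedPower.

(** * Measurability of powers with variable base and exponent *)

Section Measurability.
Context {d : measure_display} {T : measurableType d} {R : realType}.
Implicit Types f g : T -> R.

Lemma measurable_fun_eq0 f : measurable_fun [set: T] f ->
  measurable_fun [set: T] (fun x => f x == 0).
Proof.
move=> mf; apply: (measurable_fun_bool true).
rewrite (_ : _ @^-1` _ = f @^-1` [set 0]); first exact: mf.
by apply/seteqP; split => x /= /eqP.
Qed.

Lemma measurable_powR2 f g : measurable_fun [set: T] f ->
  measurable_fun [set: T] g -> measurable_fun [set: T] (fun x => f x `^ g x).
Proof.
move=> mf mg; rewrite /powR.
apply: measurable_fun_ifT => /=.
- exact: measurable_fun_eq0.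
- rewrite (_ : (fun _ => _) = (fun t => if g t == 0 then 1 else 0)); last first.
    by apply/funext => t; case: ifP.
  apply: measurable_fun_ifT => //=; exact: measurable_fun_eq0.
- apply: measurableT_comp => //; apply: measurable_funM => //.
  exact: measurableT_comp.
Qed.

Lemma measurable_pow0 f g : measurable_fun [set: T] f ->
  measurable_fun [set: T] g -> measurable_fun [set: T] (fun x => pow0 (f x) (g x)).
Proof.
move=> mf mg; apply: measurable_fun_ifT => /=.
- exact: measurable_fun_eq0.
- exact: measurable_cst.
- exact: measurable_powR2.
Qed.

Lemma measurable_tempered_power lambda f g :
  measurable_fun [set: T] f -> measurable_fun [set: T] g ->
  measurable_fun [set: T] (fun x => tempered_power lambda (f x) (g x)).
Proof.
move=> mf mg.
have mp : measurable_fun [set: T] (fun x => pos_part (g x)).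
  exact: measurable_maxr.
apply: measurable_funM; last exact: measurable_pow0.
by do 2 apply: measurableT_comp => //; apply: measurable_funM.
Qed.

End Measurability.

(** * Auxiliary estimates: a power integral and a bound free of the variable exponent *)

(** After reflection, the antiderivative [F] vanishes at infinity and equals -1/c at r - s; the
    factor r^c makes the value independent of [r]. *)
Lemma integral_far_increment (R : realType) (c r s : R) : 0 < c -> 0 < r ->
  (\int[lebesgue_measure]_(x in `]-oo, (s - r)%R]) (r `^ c * (s - x) `^ (- c - 1))%:E
   = (c^-1)%:E)%E.
Proof.
move=> c0 r0.
pose g (x : R) := r `^ c * (s + x) `^ (- c - 1).
pose F (x : R) := - (r `^ c / c * (s + x) `^ (- c)).
have cts (f : R -> R) (x : R) : derivable f x 1 -> {for x, continuous f}.
  by move=> /derivable1_diffP; exact: differentiable_continuous.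
have ds (x : R) : is_derive x 1 (fun x : R => s + x) 1.
  rewrite (_ : (fun _ => _) = (cst s + id)%R)//.
  by apply: is_derive_eq; rewrite add0r.
have dp (e x : R) : 0 < s + x ->
    is_derive x 1 ((@powR R ^~ e) \o (fun x => s + x)) (e * (s + x) `^ (e - 1) * 1).
  by move=> sx; have ? := is_derive1_powR e sx; apply: is_derive1_comp.
have dF (x : R) : r - s <= x -> is_derive x 1 F (g x).
  move=> rx.
  have sx0 : 0 < s + x by lra.
  have d2 := dp (- c) x sx0.
  rewrite (_ : F = (- (r `^ c / c)) \*: ((@powR R ^~ (- c)) \o (fun x => s + x))).
    apply: is_derive_eq.
    by rewrite /g /GRing.scale/=; field; rewrite gt_eqF.
  by apply/funext => y; rewrite /F/= /GRing.scale/= mulNr.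
have cg (x : R) : r - s <= x -> {for x, continuous g}.
  move=> rx.
  have sx0 : 0 < s + x by lra.
  have [d2 _] := dp (- c - 1) x sx0.
  apply: cvgM; first exact: cvg_cst.
  exact: (cts _ _ d2).
have g0 x : 0 <= g x by rewrite mulr_ge0// powR_ge0.
have Fy : F x @[x --> +oo] --> 0.
  rewrite -oppr0; apply: cvgN; rewrite -(mulr0 (r `^ c / c)).
  apply: cvgM; first exact: cvg_cst.
  apply/cvgr0Pnorm_lt => e e0; near=> x.
  (* The threshold solves (s + x)^(-c) = e. *)
  have ex : e `^ (- c^-1) < s + x.
    by rewrite -ltrBlDl; near: x; apply: nbhs_pinfty_gt; exact: num_real.
  rewrite ger0_norm ?powR_ge0// powRN invf_plt ?posrE// ?powR_gt0//; last first.
    by rewrite (le_lt_trans _ ex) ?powR_ge0.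
  have -> : e^-1 = e `^ (- c^-1) `^ c.
    by rewrite -powRrM mulNr mulVf ?gt_eqF// powR_inv1// ltW.
  apply: gt0_ltr_powR => //; rewrite nnegrE ?powR_ge0//.
  by rewrite ltW// (le_lt_trans _ ex) ?powR_ge0.
have cFrs : F x @[x --> (r - s)^'+] --> F (r - s).
  apply: cvg_at_right_filter.
  have [dFr _] := dF _ (lexx (r - s)).
  exact: (cts _ _ dFr).
rewrite -[(s - r)%R]opprK ge0_integration_by_substitutionNy; last 2 first.
- apply/continuous_in_subspaceT => x.
  rewrite inE/= in_itv/= opprK => xsr.
  have gx : {for - x, continuous g} by apply: cg; lra.
  rewrite (_ : (fun _ => _) = g \o -%R)//.
  by apply: continuous_comp; [exact: oppr_continuous|exact: gx].
- by move=> x _; rewrite mulr_ge0// powR_ge0.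
under eq_integral => x _ do rewrite /= opprK.
have cgw : {within `[r - s, +oo[, continuous g}.
  apply/continuous_in_subspaceT => x; rewrite inE/= in_itv/= andbT => rx.
  exact: cg.
have dF' x : r - s < x -> derivable F x 1.
  by move=> rx; have [] := dF x (ltW rx).
have dF1 : {in `]r - s, +oo[, F^`()%classic =1 g}.
  move=> x; rewrite in_itv/= andbT => rx; rewrite derive1E.
  by have [_ ->] := dF x (ltW rx).
rewrite opprB (ge0_continuous_FTC2y (fun x _ => g0 x) cgw Fy dF' cFrs dF1).
rewrite -EFinB sub0r opprK [s + _]addrC subrK powRN mulrAC divff ?mul1r//.
by rewrite gt_eqF// powR_gt0.
Unshelve. all: by end_near. Qed.

(** Used with p = alpha(x) to remove the dependence on [x]: the power [a] dominates for z <= 1, the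
    power [b] for z > 1. *)
Lemma powR_le_sum (R : realType) (a b p z : R) : 0 < a -> a <= p <= b -> 0 <= z ->
  z `^ p <= z `^ a + z `^ b.
Proof.
move=> a0 /andP[ap pb]; rewrite le_eqVlt => /predU1P[<-|z0].
  by rewrite powR0 ?addr_ge0 ?powR_ge0// gt_eqF// (lt_le_trans a0).
have [z1|z1] := leP z 1.
  by rewrite (le_trans (ger_powR _ ap)) ?z0// lerDl powR_ge0.
by rewrite (le_trans (ler_powR (ltW z1) pb))// lerDr powR_ge0.
Qed.

(** * Pointwise bounds for the integrand of an increment *)

Section KernelIncrement.
Context {R : realType}.
Variables (a b H lambda : R).
Hypotheses (a_gt1 : 1 < a) (H_lt1 : H < 1) (Ha_gt1 : 1 < H * a).
Hypothesis lambda_ge0 : 0 <= lambda.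
Implicit Types (p r s t u theta : R).

Let a_gt0 : 0 < a. Proof. exact: lt_trans a_gt1. Qed.

Let H_gt0 : 0 < H.
Proof. by rewrite -(pmulr_lgt0 _ a_gt0) (lt_trans ltr01 Ha_gt1). Qed.

(** H a > 1 and p >= a give 1/p < H. Positivity makes the power monotone near the singularity; the
    upper bound 1 serves the mean value estimate. *)
Let exponent_itv p : a <= p -> 0 < H - p^-1 <= 1.
Proof.
move=> ap; have p0 : 0 < p := lt_le_trans a_gt0 ap.
have : p^-1 < H.
  rewrite invf_plt ?posrE// -[ltLHS]mul1r ltr_pdivrMr// (lt_le_trans Ha_gt1)//.
  by rewrite mulrC ler_wpM2r// ltW.
have : 0 < p^-1 by rewrite invr_gt0.
by move=> p0V pH; rewrite subr_gt0 pH lerBlDr (le_trans (ltW H_lt1))// lerDl ltW.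
Qed.

(** The factor 2 leaves room for (2r)^H <= 2 r^H, which holds as H < 1. *)
Definition increment_scale theta r : R :=
  (2 * (theta * r `^ H)) `^ a + (2 * (theta * r `^ H)) `^ b.

(** Splitting off (2r)^(-1/p) and raising it to the power [p] gives 1/(2r), the reciprocal length of
    the near zone, whatever [p] is. *)
Lemma near_increment_powR_le p theta r u : a <= p <= b -> 0 <= theta ->
  0 < r -> u <= r ->
  (theta * `|tempered_power lambda (H - p^-1) (u + r) -
             tempered_power lambda (H - p^-1) u|) `^ p <=
  increment_scale theta r / (2 * r).
Proof.
move=> /andP[ap pb] th0 r0 ur.
have p0 : 0 < p := lt_le_trans a_gt0 ap.
have /andP[beta0 _] := exponent_itv p ap.
have r20 : 0 < 2 * r by rewrite mulr_gt0.
have yle : theta * (2 * r) `^ H <= 2 * (theta * r `^ H).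
  rewrite powRM ?(ltW r0)// mulrCA ler_wpM2r ?mulr_ge0 ?powR_ge0//.
  by apply: ler1_powR; [rewrite ler1n|exact: ltW].
have -> : increment_scale theta r / (2 * r) =
   increment_scale theta r * (2 * r) `^ (- p^-1) `^ p.
  by rewrite -powRrM mulNr mulVf ?gt_eqF// powR_inv1// ltW.
apply: (@le_trans _ _ ((theta * (2 * r) `^ (H - p^-1)) `^ p)).
  rewrite ge0_ler_powR ?nnegrE ?mulr_ge0 ?powR_ge0 ?(ltW p0)//.
  rewrite ler_wpM2l// tempered_power_near_increment// ltW//.
rewrite powRD; last by rewrite gt_eqF// implybT.
rewrite mulrA powRM ?mulr_ge0 ?powR_ge0// ler_wpM2r ?powR_ge0//.
apply: (@le_trans _ _ ((2 * (theta * r `^ H)) `^ p)).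
  by rewrite ge0_ler_powR ?nnegrE ?mulr_ge0 ?powR_ge0 ?(ltW p0).
by apply: powR_le_sum; rewrite ?ap ?mulr_ge0 ?powR_ge0.
Qed.

(** The mean value bound factors as r^H (r/u)^(1-H) u^(-1/p). Its p-th power contains (r/u)^((1-H)p)
    / u, where [p] may be lowered to [a] because r/u <= 1; this decay is integrable at infinity. *)
Lemma far_increment_powR_le p theta r u : a <= p <= b -> 0 <= theta ->
  0 < r -> r <= u ->
  (theta * `|tempered_power lambda (H - p^-1) (u + r) -
             tempered_power lambda (H - p^-1) u|) `^ p <=
  increment_scale theta r * (r `^ ((1 - H) * a) * u `^ (- ((1 - H) * a) - 1)).
Proof.
move=> /andP[ap pb] th0 r0 ru.
have u0 : 0 < u := lt_le_trans r0 ru.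
have p0 : 0 < p := lt_le_trans a_gt0 ap.
have beta01 := exponent_itv p ap.
set y := theta * r `^ H.
have y0 : 0 <= y by rewrite mulr_ge0 ?powR_ge0.
apply: (@le_trans _ _ ((theta * (r * u `^ (H - p^-1 - 1))) `^ p)).
  rewrite ge0_ler_powR ?nnegrE ?mulr_ge0 ?powR_ge0 ?(ltW p0) ?(ltW r0)//.
  by rewrite ler_wpM2l// tempered_power_far_increment.
have -> : theta * (r * u `^ (H - p^-1 - 1)) =
    y * ((r / u) `^ (1 - H) * u `^ (- p^-1)).
  have powu e : (r / u) `^ e = r `^ e * u `^ (- e).
    by rewrite powRM ?invr_ge0 ?(ltW r0) ?(ltW u0)//
      -powR_inv1 ?(ltW u0)// -powRrM mulN1r.
  rewrite powu /y [in LHS](_ : r = r `^ H * r `^ (1 - H)); last first.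
    by rewrite -powRD ?subrKC ?powRr1 ?(ltW r0)// (gt_eqF r0) implybT.
  rewrite (_ : H - p^-1 - 1 = - (1 - H) + - p^-1); last by ring.
  rewrite [u `^ (_ - p^-1)]powRD; last by rewrite (gt_eqF u0) implybT.
  by ring.
have -> : r `^ ((1 - H) * a) * u `^ (- ((1 - H) * a) - 1) =
    (r / u) `^ ((1 - H) * a) * u^-1.
  rewrite powRM ?invr_ge0 ?(ltW r0) ?(ltW u0)//
      -powR_inv1 ?(ltW u0)// -powRrM mulN1r.
  by rewrite -mulrA -powRD// (gt_eqF u0) implybT.
rewrite powRM ?mulr_ge0 ?powR_ge0// ler_pM ?powR_ge0//.
  apply: (@le_trans _ _ ((2 * y) `^ p)).
    rewrite ge0_ler_powR ?nnegrE ?mulr_ge0 ?powR_ge0 ?(ltW p0)//.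
    by rewrite ler_peMl// ler1n.
  by apply: powR_le_sum; rewrite ?ap ?mulr_ge0 ?powR_ge0.
rewrite powRM ?powR_ge0// -!powRrM mulNr mulVf ?gt_eqF// powR_inv1 ?(ltW u0)//.
rewrite ler_wpM2r ?invr_ge0 ?(ltW u0)//.
apply: ger_powR; last by rewrite ler_wpM2l// subr_ge0 ltW.
by rewrite divr_gt0//= ler_pdivrMr// mul1r.
Qed.
End KernelIncrement.

(** * Integral bound for kernel increments *)

Section KernelIntegral.
Context {R : realType}.
Notation mu := (@lebesgue_measure R).
Variables (a b H lambda : R) (alpha : R -> R).
Hypotheses (a_gt1 : 1 < a) (H_lt1 : H < 1) (Ha_gt1 : 1 < H * a).
Hypothesis lambda_ge0 : 0 <= lambda.
Hypotheses (alpha_ab : forall x, a <= alpha x <= b) (alpha_cont : continuous alpha).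
Implicit Types (s t theta : R).

Let a_gt0 : 0 < a. Proof. exact: lt_trans a_gt1. Qed.

Let alpha_gt0 x : 0 < alpha x.
Proof. by have /andP[+ _] := alpha_ab x; exact: lt_le_trans. Qed.

Lemma measurable_kernel t : measurable_fun [set: R] (ltfm_kernel H alpha lambda t).
Proof.
have mbeta : measurable_fun [set: R] (fun x => H - (alpha x)^-1).
  apply: continuous_measurable_fun => x; apply: cvgB; first exact: cvg_cst.
  by apply: cvgV; [rewrite gt_eqF|exact: alpha_cont].
apply: measurable_funB; apply: measurable_tempered_power => //.
  by apply: measurable_funB.
Qed.

Lemma measurable_kernel_powR (f : R -> R) : measurable_fun [set: R] f ->
  measurable_fun [set: R] (fun x => (`|f x| `^ alpha x)%:E).
Proof.
move=> mf; apply/measurable_EFinP; apply: measurable_powR2.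
  exact: measurableT_comp.
exact: continuous_measurable_fun.
Qed.

Lemma kernelB t s x :
  ltfm_kernel H alpha lambda t x - ltfm_kernel H alpha lambda s x =
  tempered_power lambda (H - (alpha x)^-1) (t - x) -
  tempered_power lambda (H - (alpha x)^-1) (s - x).
Proof. by rewrite /ltfm_kernel /tempered_power; ring. Qed.

(** There are three zones: x <= s - r is far, s - r < x <= t is near and has length 2r, and beyond
    [t] both terms vanish. The near zone contributes the 1 in the constant, the far zone the
    1/((1-H)a). *)
Lemma integral_kernel_increment_le theta s t : s < t ->
  (\int[mu]_x (`|theta * (ltfm_kernel H alpha lambda t x -
                          ltfm_kernel H alpha lambda s x)| `^ alpha x)%:E <=
   ((1 + ((1 - H) * a)^-1) * increment_scale a b H `|theta| (t - s))%:E)%E.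
Proof.
move=> st.
pose r := t - s; have r0 : 0 < r by rewrite subr_gt0.
pose c := (1 - H) * a; have c0 : 0 < c by rewrite mulr_gt0// subr_gt0.
pose C := increment_scale a b H `|theta| r.
have C0 : 0 <= C by rewrite addr_ge0// powR_ge0.
pose near_set := [set` `[s - r, t]].
pose far_set := [set` `]-oo, s - r]].
pose h1 : R -> \bar R := (fun=> (C / (2 * r))%:E) \_ near_set.
pose far x : R := r `^ c * (s - x) `^ (- c - 1).
pose h2 : R -> \bar R := (fun x => C%:E * (far x)%:E)%E \_ far_set.
have mfar : measurable_fun [set: R] far.
  apply: measurable_funM => //.
  by apply: (measurableT_comp (measurable_powR _)); exact: measurable_funB.
have h10 x : (0 <= h1 x)%E.
  rewrite /h1 patchE; case: ifP => // _.
  by rewrite lee_fin divr_ge0// mulr_ge0// ltW.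
have h20 x : (0 <= h2 x)%E.
  rewrite /h2 patchE; case: ifP => // _.
  by rewrite mule_ge0 ?lee_fin// mulr_ge0 ?powR_ge0.
have mh1 : measurable_fun [set: R] h1.
  apply: (measurable_restrictT _ _).1; first exact: measurable_itv.
  exact: measurable_cst.
have mh2 : measurable_fun [set: R] h2.
  apply: (measurable_restrictT _ _).1; first exact: measurable_itv.
  apply: measurable_funeM.
  by apply/measurable_EFinP; exact: measurable_funTS.
apply: (@le_trans _ _ (\int[mu]_x (h1 x + h2 x))%E).
  apply: ge0_le_integral => //.
  - apply: measurable_kernel_powR; apply: measurable_funM => //.
    by apply: measurable_funB; exact: measurable_kernel.
  - exact: emeasurable_funD.
  move=> x _; rewrite kernelB normrM.
  have -> : t - x = (s - x) + r by rewrite /r; ring.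
  have [xsr|xsr] := leP x (s - r).
    have h2x : h2 x = (C * far x)%:E by rewrite /h2 patchE mem_set//= in_itv.
    rewrite (@le_trans _ _ (h2 x))//; last by rewrite leeDr.
    rewrite h2x lee_fin; apply: far_increment_powR_le => //.
    by rewrite lerBrDl -lerBrDr.
  have [xt|xt] := leP x t.
    have h1x : h1 x = (C / (2 * r))%:E.
      by rewrite /h1 patchE mem_set// /near_set/= in_itv/= (ltW xsr).
    rewrite (@le_trans _ _ (h1 x))//; last by rewrite leeDl.
    rewrite h1x lee_fin; apply: near_increment_powR_le => //.
    by rewrite lerBlDr -lerBlDl ltW.
  rewrite !tempered_power_le0 ?subrr ?normr0 ?mulr0 ?powR0 ?gt_eqF//.
  - by rewrite adde_ge0.
  - by rewrite subr_le0 (le_trans (ltW st)) ?ltW.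
  - by rewrite /r addrACA addrA; lra.
rewrite ge0_integralD//.
rewrite /h1 /h2 -!integral_mkcond ge0_integralZl//; last 3 first.
- exact: measurable_itv.
- by apply/measurable_EFinP; exact: measurable_funTS.
- by move=> x _; rewrite lee_fin mulr_ge0 ?powR_ge0.
have near_length : mu near_set = (2 * r)%:E.
  rewrite /near_set lebesgue_measure_itv/= lte_fin ifT; last by lra.
  by rewrite -EFinB /r; congr EFin; ring.
rewrite integral_far_increment// integral_cst; last exact: measurable_itv.
rewrite -[X in (_ * X)%E]/(mu near_set) near_length -!EFinM -EFinD lee_fin.
rewrite divfK ?mulf_neq0 ?gt_eqF// -/c -/r -/C.
by rewrite [leRHS](_ : _ = C + C / c)//; ring.
Qed.
(** The kernel at time 0 vanishes, so the kernel at [t] is, up to sign, an increment, bounded by the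
    previous estimate with theta = 1. *)
Lemma kernel_multistable_integrable t :
  multistable_integrable alpha (ltfm_kernel H alpha lambda t).
Proof.
split; first exact: measurable_kernel.
have kernel0 x : ltfm_kernel H alpha lambda 0 x = 0.
  by rewrite /ltfm_kernel sub0r subrr.
have [t0|t0|->] := ltgtP t 0.
- apply: le_lt_trans (ltry _).
  apply: le_trans (integral_kernel_increment_le 1 _ _ t0).
  rewrite le_eqVlt; apply/orP; left; apply/eqP; apply: eq_integral => x _.
  by rewrite kernel0 sub0r mul1r normrN.
- apply: le_lt_trans (ltry _).
  apply: le_trans (integral_kernel_increment_le 1 _ _ t0).
  rewrite le_eqVlt; apply/orP; left; apply/eqP; apply: eq_integral => x _.
  by rewrite kernel0 subr0 mul1r.
rewrite integral0_eq ?ltry// => x _; rewrite kernel0 normr0 powR0//.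
rewrite gt_eqF//.
Qed.

End KernelIntegral.

(** * From the finite-dimensional laws to the paths *)

Section Increments.
Context {R : realType} {d : measure_display} {Omega : measurableType d}.
Variables (P : probability Omega R) (a b H lambda : R) (alpha : R -> R).
Hypotheses (a_gt1 : 1 < a) (H_lt1 : H < 1) (Ha_gt1 : 1 < H * a).
Hypothesis lambda_ge0 : 0 <= lambda.
Hypotheses (alpha_ab : forall x, a <= alpha x <= b) (alpha_cont : continuous alpha).
Implicit Types s t theta : R.

Variable X : R -> {RV P >-> R}.
Hypothesis X_LTFmSM : LTFmSM H alpha lambda X.

Let integrable_kernel t :
  multistable_integrable alpha (ltfm_kernel H alpha lambda t).
Proof. exact: (kernel_multistable_integrable a b). Qed.

(** The joint law at times t, s with coefficients theta, -theta has real part e^(-v), and 1 - e^(-v)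
    <= v. *)
Lemma one_sub_cf_increment_le s t theta : s < t -> 0 < theta ->
  1 - \int[P]_w cos (theta * (X t w - X s w)) <=
  (1 + ((1 - H) * a)^-1) *
    ((theta * (2 * (t - s) `^ H)) `^ a + (theta * (2 * (t - s) `^ H)) `^ b).
Proof.
move=> st th0.
pose th (k : 'I_2) : R := if k == ord0 then theta else - theta.
pose ts (k : 'I_2) := if k == ord0 then t else s.
have /(congr1 (@complex.Re R))/= :=
  X_LTFmSM 2%N th ts (fun k => integrable_kernel (ts k)).
have -> : \int[P]_w cos (\sum_(k < 2%N) th k * X (ts k) w) =
    \int[P]_w cos (theta * (X t w - X s w)).
  apply: eq_Rintegral => w _; congr cos.
  by rewrite !big_ord_recl big_ord0 /th /ts/= addr0 mulNr -mulrBr.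
move=> ->.
set v := Rintegral _ _ _.
rewrite lerBlDr -lerBlDl (le_trans _ (expR_ge1Dx _))// lerD2l lerN2.
have E : v = fine (\int[lebesgue_measure]_x
    (`|theta * (ltfm_kernel H alpha lambda t x -
                ltfm_kernel H alpha lambda s x)| `^ alpha x)%:E).
  rewrite /v /Rintegral; congr fine; apply: eq_integral => x _.
  by rewrite !big_ord_recl big_ord0 /th /ts/= addr0 mulNr -mulrBr.
have := integral_kernel_increment_le _ _ _ _ _ a_gt1 H_lt1 Ha_gt1 lambda_ge0
  alpha_ab alpha_cont theta _ _ st.
rewrite /increment_scale (gtr0_norm th0) !(mulrCA 2 theta) => le.
(* [fine] would send an infinite integral to 0; [le] also supplies the finiteness needed here. *)
rewrite E -lee_fin fineK//.
rewrite ge0_fin_numE ?(le_lt_trans le) ?ltry//.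
by apply: integral_ge0 => x _; rewrite lee_fin powR_ge0.
Qed.

(* The summand 1 covers the case delta < 2 |t - s|^H, where the bound is trivial. *)
Let D : R := 2 * (1 + ((1 - H) * a)^-1) / (1 - cos 1) / (1 - 2 `^ (- a)) + 1.

Lemma increment_tail_le s t (delta : R) : s != t -> 0 < delta ->
  (P [set w | `|X t w - X s w|%R \in `[delta, +oo[%R] <=
   (D * (2 * `|t - s| `^ H / delta) `^ a)%:E)%E.
Proof.
wlog st : s t / s < t.
  move=> wl; rewrite neq_lt => /orP[st|ts]; first by apply: wl; rewrite ?lt_eqF.
  rewrite distrC (_ : [set w | _] = [set w | `|X s w - X t w| \in `[delta, +oo[]).
    by apply: wl; rewrite ?lt_eqF.
  by apply/seteqP; split => w /=; rewrite distrC.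
move=> _ d0; rewrite ger0_norm ?subr_ge0 ?(ltW st)//.
set rho := 2 * (t - s) `^ H.
have a0 : 0 < a := lt_trans ltr01 a_gt1.
have K0 : 0 <= 1 + ((1 - H) * a)^-1.
  by rewrite addr_ge0// invr_ge0 mulr_ge0 ?subr_ge0 ?(ltW H_lt1) ?(ltW a0).
have rho0 : 0 < rho by rewrite mulr_gt0// powR_gt0// subr_gt0.
have D0 : 0 <= D - 1.
  rewrite /D addrK divr_ge0 ?subr_ge0 ?(ltW (powR2N_lt1 _ _ a0))//.
  by rewrite divr_ge0 ?(ltW one_sub_cos1_gt0)// mulr_ge0.
pose Y : {RV P >-> R} := (X t \- X s)%R.
have [rd|dr] := leP rho delta.
  have ab : a <= b by have /andP[h1 h2] := alpha_ab 0; exact: le_trans h2.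
  have cfY theta : 0 < theta -> 1 - \int[P]_w cos (theta * Y w) <=
      (1 + ((1 - H) * a)^-1) * ((theta * rho) `^ a + (theta * rho) `^ b).
    by move=> theta0; exact: one_sub_cf_increment_le.
  have := tail_probability_le P Y _ _ _ _ _ a0 ab K0 rho0 rd cfY.
  move=> /le_trans; apply; rewrite lee_fin ler_wpM2r ?powR_ge0//.
  by rewrite /D lerDl.
apply: (@le_trans _ _ 1%E).
  by apply: probability_le1; exact: (measurable_norm_itv P Y).
rewrite lee_fin -[leLHS]mul1r ler_pM//; first by rewrite -subr_ge0.
rewrite -[leLHS](_ : 1 `^ a = 1); last by rewrite powR1.
rewrite ge0_ler_powR ?(ltW a0) ?nnegrE ?divr_ge0 ?(ltW rho0) ?(ltW d0)//.
by rewrite ler_pdivlMr// mul1r ltW.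
Qed.

(** Borel-Cantelli with a union bound over the 2^n increments of level [n]; [e] = 1 or -1 selects
    the side of [t]. *)
Lemma dyadic_increments_ae t (e g : R) : `|e| = 1 -> g < H - a^-1 ->
  {ae P, forall w, exists N : nat, forall n k : nat, (N <= n)%N -> (k < 2 ^ n)%N ->
    `|X (t + e * (k.+1%:R / 2 ^+ n)) w - X (t + e * (k%:R / 2 ^+ n)) w| <=
      (2 `^ (- g)) ^+ n}.
Proof.
move=> e1 gH.
have a0 : 0 < a := lt_trans ltr01 a_gt1.
pose x n k : R := t + e * (k%:R / 2 ^+ n).
pose A n k :=
  [set w | `|X (x n k.+1) w - X (x n k) w| \in `[(2 `^ (- g)) ^+ n, +oo[].
pose B n := \big[setU/set0]_(k < (2 ^ n)%N) A n k.
have mA n k : measurable (A n k).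
  exact: (measurable_norm_itv P (X (x n k.+1) \- X (x n k))).
have mB n : measurable (B n) by apply: bigsetU_measurable.
pose z : R := 2 `^ (- ((H - g) * a)).
have D0 : 0 <= D.
  rewrite addr_ge0// divr_ge0 ?subr_ge0 ?(ltW (powR2N_lt1 _ _ a0))//.
  rewrite divr_ge0 ?(ltW one_sub_cos1_gt0)// mulr_ge0// addr_ge0//.
  by rewrite invr_ge0 mulr_ge0 ?subr_ge0 ?(ltW H_lt1) ?(ltW a0).
have PA n k : (P (A n k) <= (D * 2 `^ a * z ^+ n)%:E)%E.
  have n0 : 0 < 2 ^+ n :> R by rewrite exprn_gt0.
  have xx : `|x n k.+1 - x n k| = (2 ^+ n)^-1.
    rewrite /x (_ : _ - _ = e * (2 ^+ n)^-1); last by rewrite -natr1; ring.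
    by rewrite normrM e1 mul1r ger0_norm// invr_ge0 ltW.
  have ne : x n k != x n k.+1.
    by rewrite eq_sym -subr_eq0 -normr_eq0 xx invr_eq0 gt_eqF.
  have q0 : 0 < (2 `^ (- g)) ^+ n :> R by rewrite exprn_gt0// powR_gt0.
  apply: (le_trans (increment_tail_le _ _ _ ne q0)).
  rewrite xx lee_fin -[leRHS]mulrA ler_wpM2l// -[2 * _ / _]mulrA.
  rewrite powRM ?divr_ge0 ?powR_ge0 ?(ltW q0)// ler_wpM2l ?powR_ge0//.
  rewrite le_eqVlt; apply/orP; left; apply/eqP.
  rewrite -powR_invn// -!powR_mulrn ?powR_ge0// -!powRrM -powRN -powRrM.
  rewrite -powRD; last first.
    by rewrite pnatr_eq0 implybT.
  by rewrite -powRrM; congr (_ `^ _); ring.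
have PB n : (P (B n) <= (D * 2 `^ a * (2 * z) ^+ n)%:E)%E.
  rewrite (le_trans (Boole_inequality _ _))//.
  apply: (@le_trans _ _ (\sum_(k < (2 ^ n)%N) (D * 2 `^ a * z ^+ n)%:E)%E).
    by apply: lee_sum => k _; exact: PA.
  by rewrite sumEFin lee_fin sumr_const card_ord -[leLHS]mulr_natl natrX exprMn mulrCA.
(* g < H - 1/a means (H - g) a > 1, so the decay of each probability beats the number 2^n of
   events. *)
have z21 : 2 * z < 1.
  rewrite -{1}(@powRr1 R 2)// /z -powRD; last by rewrite pnatr_eq0 implybT.
  rewrite -opprB; apply: powR2N_lt1.
  by rewrite subr_gt0 -ltr_pdivrMr// div1r; lra.
have limB : P (lim_sup_set B) = 0%E.
  apply: lim_sup_set_cvg0 => //.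
  apply: le_lt_trans (ltry _).
  apply: (nneseries_geometric_le _ _ _ _ _ _ _ PB) => //.
    by rewrite mulr_ge0 ?powR_ge0.
  by rewrite mulr_ge0 ?powR_ge0.
apply: (@negligibleS _ _ _ _ (lim_sup_set B)); last first.
  apply/negligibleP => //.
  by apply: bigcap_measurable => // n _; apply: bigcup_measurable => j _; exact: mB.
(* If [w] avoided every [B m] with m >= n, then N = n would satisfy the claim. *)
move=> w /= bad n _.
apply: contrapT => nB; apply: bad; exists n => m k nm km.
rewrite leNgt; apply/negP => gtq; apply: nB.
exists m => //; rewrite /B -bigcup_mkord; exists k => //.
by rewrite /A/= in_itv/= andbT ltW.
Qed.

Variable Y : R -> {RV P >-> R}.
Hypotheses (Y_version : version Y X) (Y_cont : continuous_paths Y).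

Lemma holder_quotient_cvg0_ae t (h : R) : h < H - a^-1 ->
  {ae P, forall w,
    (fun r : R => `|Y (t + r) w - Y t w| / (`|r| `^ h)) @ 0^' --> (0 : R)}.
Proof.
move=> hH.
have HaV : 0 < H - a^-1.
  by rewrite subr_gt0 -div1r ltr_pdivrMr// (lt_trans ltr01 a_gt1).
(* Positivity of [g] makes 2^(-g) a contraction ratio for the chaining; g > h makes the quotient
   vanish. *)
have [g [g0 hg gH]] : exists g : R, [/\ 0 < g, h < g & g < H - a^-1].
  exists ((Num.max h 0 + (H - a^-1)) / 2).
  have m1 : Num.max h 0 < H - a^-1 by rewrite gt_max hH.
  have m2 : h <= Num.max h 0 by rewrite le_max lexx.
  have m3 : 0 <= Num.max h 0 by rewrite le_max lexx orbT.
  by split; lra.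
(* [Y] and [X] agree almost surely only at each fixed time; the dyadic points are countable, so one
   null set serves them all, and chaining then uses only the continuity of [Y]. *)
have versionE (e : R) : {ae P, forall w, forall n k : nat,
    Y (t + e * (k%:R / 2 ^+ n)) w = X (t + e * (k%:R / 2 ^+ n)) w}.
  by do 2 apply: ae_foralln => ?; exact: Y_version.
have ae_side (e : R) : `|e| = 1 -> {ae P, forall w, exists N : nat,
    forall m (r : R), (N <= m)%N -> 0 <= r < (2 ^+ m)^-1 ->
    `|Y (t + e * r) w - Y t w| <= (1 - 2 `^ (- g))^-1 * (2 `^ (- g)) ^+ m}.
  move=> e1; have := dyadic_increments_ae t e g e1 gH.
  move: (versionE e) Y_cont; apply: filterS3 => w YX cY [N XN].
  exists N => m r Nm rm.
  have q01 : 0 < 2 `^ (- g) < (1 : R) by rewrite powR_gt0// powR2N_lt1.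
  pose f s := Y (t + e * s) w.
  have cf : continuous f.
    move=> s; have lin : t + e * u @[u --> s] --> t + e * s.
      apply: cvgD; first exact: cvg_cst.
      by apply: cvgM; [exact: cvg_cst|exact: cvg_id].
    exact: continuous_cvg (cY _) lin.
  have f_incr n k : (N <= n)%N -> (k < 2 ^ n)%N ->
      `|f (k.+1%:R / 2 ^+ n) - f (k%:R / 2 ^+ n)| <= 2 `^ (- g) ^+ n.
    by move=> Nn kn; rewrite /f !YX; exact: XN.
  have := dyadic_increment_bound _ f _ _ _ _ q01 cf f_incr Nm rm.
  by rewrite [leRHS]mulrC /f mulr0 addr0.
have := ae_side (-1) ltac:(by rewrite normrN normr1).
apply: filterS2 (ae_side 1 (normr1 _)) => w [N1 right_le] [N2 left_le].
apply: (cvg_holder_quotient _ (fun s => Y s w) t g h (1 - 2 `^ (- g))^-1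
  (maxn N1 N2)) => //.
  by rewrite invr_ge0 subr_ge0 ltW// powR2N_lt1.
move=> m r; rewrite geq_max => /andP[N1m N2m] rm.
have [r0|r0] := leP 0 r.
  rewrite -[r]mul1r; apply: right_le => //.
  by rewrite r0 -(ger0_norm r0).
rewrite -[r]opprK -mulN1r; apply: left_le => //.
by rewrite oppr_ge0 ltW//= -(ltr0_norm r0).
Qed.
End Increments.

Theorem proposition14 (R : realType) (d : measure_display)
  (Omega : measurableType d) (P : probability Omega R)
  (a b : R) (alpha : R -> R) (H lambda : R)
  (a_gt1 : 1 < a) (le_ab : a <= b) (b_le2 : b <= 2)
  (alpha_ab : forall x, a <= alpha x <= b)
  (alpha_cont : continuous alpha)
  (H_gt0 : 0 < H) (H_lt1 : H < 1) (Ha_gt1 : 1 < H * a)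
  (lambda_gt0 : 0 < lambda)
  (X0 X : R -> {RV P >-> R})
  (X0_LTFmSM : LTFmSM H alpha lambda X0)
  (X_version : version X X0)
  (X_cont : continuous_paths X) :
  forall t : R,
    {ae P, forall w, ((H - a^-1)%:E <= holder_exponent (fun s : R => X s w) t)%E}.
Proof.
move=> t.
(* The null set depends on the exponent, so only the countably many exponents H - 1/a - 1/(n+1),
   which approach H - 1/a, are used. *)
have quotient_ae : {ae P, forall w, forall n : nat,
    (fun r : R => `|X (t + r) w - X t w| / (`|r| `^ (H - a^-1 - n.+1%:R^-1))) @ 0^'
      --> (0 : R)}.
  apply: ae_foralln => n.
  apply: (holder_quotient_cvg0_ae P a b H lambda alpha a_gt1 H_lt1 Ha_gt1
    (ltW lambda_gt0) alpha_ab alpha_cont X0 X0_LTFmSM X X_version X_cont).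
  by rewrite ltrBlDr ltrDl invr_gt0.
apply: filterS quotient_ae => w quotient_cvg0.
apply/lee_subgt0Pr => e e0.
have [n ne] : exists n : nat, n.+1%:R^-1 <= e.
  exists (Num.truncn e^-1); rewrite invf_ple ?posrE//.
  have eV0 : 0 <= e^-1 by rewrite invr_ge0 ltW.
  by have /andP[_ /ltW] := truncn_itv eV0.
apply: (@le_trans _ _ (H - a^-1 - n.+1%:R^-1)%:E).
  by rewrite -EFinB lee_fin lerD2l lerN2.
apply: ereal_sup_ubound; exists (H - a^-1 - n.+1%:R^-1) => //.
exact: quotient_cvg0.
Qed.
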